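(* Suppose $\mathbb K\neq\mathbb R$. Let $d$ be a metric on $\mathfrak H_{\mathbb K}$, and denote again by $d$ its extension to $\partial\mathbf{H}^n_{\mathbb K}=\mathfrak H_{\mathbb K}\cup\{\infty\}$. Suppose that all of the following hold: (Sim) $\mathrm{Sim}_{d_{\mathfrak H}}\subseteq\mathrm{Sim}_d$; (Top) every sequence $(p_\nu)_{\nu\in\mathbb N}$ in $\partial\mathbf{H}^n_{\mathbb K}$ which converges in the $d_{\mathfrak H}$-topology of $\partial\mathbf{H}^n_{\mathbb K}$ converges in the $d$-topology of $\partial\mathbf{H}^n_{\mathbb K}$; (Inv) the inversion $I$ belongs to $\mathcal M_d$. Then there exist constants $\beta>0$ and $\alpha\in(0,1]$ such that $d=\beta\cdot d_{\mathfrak H}^{\alpha}$.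
   Context: $\mathbb K$ is one of $\mathbb R,\mathbb C,\mathbb H,\mathbb O$ (reals, complex numbers, quaternions, octonions), with conjugation $z\mapsto\overline z$ (the identity if $\mathbb K=\mathbb R$) and norm $|z|$; $n\ge 2$ is an integer, and $n=2$ if $\mathbb K=\mathbb O$. Put $\Im(\mathbb K)=\{z\in\mathbb K: z=-\overline z\}$, $\operatorname{Im}z=(z-\overline z)/2$, and $\|\zeta\|^2=\sum_i|\zeta_i|^2$ for $\zeta\in\mathbb K^{n-1}$. The $\mathbb K$-Heisenberg group $\mathfrak H_{\mathbb K}$ is the set $\mathbb K^{n-1}\times\Im(\mathbb K)$ with the multiplication $(\zeta,v)*(\zeta',v')=(\zeta+\zeta',\,v+v'+2\omega(\zeta,\zeta'))$, where $\omega(\zeta,\zeta')=\operatorname{Im}\big(\sum_i\overline{\zeta'_i}\zeta_i\big)$; thus $(\zeta,v)^{-1}=(-\zeta,-v)$, and the origin is $o=(0,0)$. The boundary of $\mathbb K$-hyperbolic space is identified with $\partial\mathbf{H}^n_{\mathbb K}=\mathfrak H_{\mathbb K}\cup\{\infty\}$. The Korányi gauge is $|(\zeta,v)|_{\mathbb K}=(\|\zeta\|^4+|v|^2)^{1/4}$ and the Korányi metric is $d_{\mathfrak H}(p,q)=|q^{-1}*p|_{\mathbb K}$ on $\mathfrak H_{\mathbb K}$. Any metric $d$ on $S=\mathfrak H_{\mathbb K}$ (in particular $d_{\mathfrak H}$) is extended to $\overline S=S\cup\{\infty\}$ by $d(p,\infty)=+\infty$ for $p\in S$ and $d(\infty,\infty)=0$.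 The $d$-topology on $\overline S$ is the one extending the metric topology of $S$ for which the sets $\{q\in S:d(o,q)>R\}\cup\{\infty\}$, $R>0$, are basic neighbourhoods of $\infty$. For pairwise distinct $p_1,\dots,p_4\in\overline S$ the metric cross-ratio is $|\mathbb X^d|(p_1,p_2,p_3,p_4)=\frac{d(p_4,p_2)}{d(p_4,p_1)}\cdot\frac{d(p_3,p_1)}{d(p_3,p_2)}$, where, if one of the points is $\infty$, the two factors containing $\infty$ are cancelled. The Möbius group $\mathcal M_d$ is the group of homeomorphisms of $\overline S$ (in the $d$-topology) which leave $|\mathbb X^d|$ invariant on all quadruples of pairwise distinct points. The similarity group $\mathrm{Sim}_d$ is the set of $\phi\in\mathcal M_d$ for which there is a constant $K(\phi)>0$ with $d(\phi(p),\phi(q))=K(\phi)\,d(p,q)$ for all $p,q\in S$. The inversion $I:\partial\mathbf{H}^n_{\mathbb K}\to\partial\mathbf{H}^n_{\mathbb K}$ is given by $I(\zeta,v)=\big(\zeta(-\|\zeta\|^2+v)^{-1},\ \overline v\,|-\|\zeta\|^2+v|^{-2}\big)$ for $(\zeta,v)\neq o$ in $\mathfrak H_{\mathbb K}$ (each coordinate of $\zeta$ multiplied on the right), $I(o)=\infty$, $I(\infty)=o$. *)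

(* Defs.v *)
From HB Require Import structures.
From mathcomp Require Import all_boot all_order all_algebra.
From mathcomp Require Import all_classical all_reals all_analysis.

Set Implicit Arguments.
Unset Strict Implicit.
Unset Printing Implicit Defensive.

Import Order.TTheory GRing.Theory Num.Theory.
Import numFieldNormedType.Exports.

Local Open Scope classical_set_scope.
Local Open Scope ring_scope.

Section CayleyDickson.
Variable R : realType.

Fixpoint cd (k : nat) : lmodType R :=
  if k is k'.+1 then (cd k' * cd k')%type : lmodType R else R^o.

Fixpoint cd_conj (k : nat) : cd k -> cd k :=
  match k with
  | 0 => fun x => x
  | k'.+1 => fun x => (cd_conj x.1, - x.2)
  end.

(* Doubling (a, b) * (c, d) = (a c - d^* b, d a + b c^* ), read as a + b l;
   the order of the factors matters from the octonions on. *)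
Fixpoint cd_mul (k : nat) : cd k -> cd k -> cd k :=
  match k with
  | 0 => fun x y : R => x * y
  | k'.+1 => fun x y =>
      (cd_mul x.1 y.1 - cd_mul (cd_conj y.2) x.2,
       cd_mul y.2 x.1 + cd_mul x.2 (cd_conj y.1))
  end.

Fixpoint cd_real (k : nat) : R -> cd k :=
  match k with
  | 0 => fun a => a
  | k'.+1 => fun a => (cd_real k' a, 0)
  end.

Fixpoint cd_re (k : nat) : cd k -> R :=
  match k with
  | 0 => fun x => x
  | k'.+1 => fun x => cd_re x.1
  end.

Lemma cd_conj_is_linear k : linear (@cd_conj k).
Proof.
elim: k => [|k IH] a x y //=.
rewrite IH; congr pair; rewrite opprD; congr (_ - _); exact: (esym (scalerN _ _)).
Qed.

HB.instance Definition _ k :=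
  GRing.isLinear.Build R (cd k) (cd k) _ (@cd_conj k) (@cd_conj_is_linear k).

Lemma cd_conjK k : involutive (@cd_conj k).
Proof. by elim: k => [|k IH] // [x y] /=; rewrite IH opprK. Qed.

End CayleyDickson.

Inductive division_algebra := RR | CC | HH | OO.

Definition cd_level (K : division_algebra) : nat :=
  match K with RR => 0 | CC => 1 | HH => 2 | OO => 3 end.

Section Algebra.
Variables (R : realType) (K : division_algebra).

Definition alg : lmodType R := cd R (cd_level K).

Definition kconj : alg -> alg := @cd_conj R (cd_level K).
Definition kmul : alg -> alg -> alg := @cd_mul R (cd_level K).
Definition kreal : R -> alg := @cd_real R (cd_level K).

(* |z|^2 is the real number z z^* *)
Definition knorm (z : alg) : R :=
  Num.sqrt (@cd_re R (cd_level K) (kmul z (kconj z))).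

Definition kinv (z : alg) : alg := (knorm z ^- 2) *: kconj z.

HB.instance Definition _ := GRing.Linear.on kconj.

Definition imaginary : {pred alg} := [pred z | z == - kconj z].

Lemma imaginary_submod_closed : submod_closed imaginary.
Proof.
split=> [|a x y]; rewrite !inE; first by rewrite raddf0 oppr0.
move=> /eqP hx /eqP hy; apply/eqP.
by rewrite linearP opprD -scalerN -hx -hy.
Qed.

HB.instance Definition _ :=
  GRing.isSubmodClosed.Build R alg imaginary imaginary_submod_closed.

Definition ImK := {z : alg | z \in imaginary}.

HB.instance Definition _ := SubType.on ImK.
HB.instance Definition _ := Choice.on ImK.
HB.instance Definition _ := [SubChoice_isSubLmodule of ImK by <:].

Lemma im_part_subproof (z : alg) : (2^-1 : R) *: (z - kconj z) \in imaginary.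
Proof.
apply: rpredZ; rewrite inE raddfB /=.
by have -> : kconj (kconj z) = z by [exact: cd_conjK]; rewrite opprB.
Qed.

Definition im_part (z : alg) : ImK :=
  exist _ ((2^-1 : R) *: (z - kconj z)) (im_part_subproof z).

Lemma im_conj_subproof (v : ImK) : kconj (val v) \in imaginary.
Proof.
have /eqP hv : val v \in imaginary := valP v.
have -> : kconj (val v) = - val v by rewrite [in RHS]hv opprK.
by rewrite rpredN; exact: valP.
Qed.

Definition im_conj (v : ImK) : ImK :=
  exist _ (kconj (val v)) (im_conj_subproof v).

End Algebra.

Section Heisenberg.
Variables (R : realType) (K : division_algebra) (n : nat).

Definition heis : choiceType := ('rV[alg R K]_n.-1 * ImK R K)%type.

Implicit Types p q : heis.

Definition horigin : heis := (0, 0).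

Definition omega (z w : 'rV[alg R K]_n.-1) : ImK R K :=
  im_part (\sum_i kmul (kconj (w ord0 i)) (z ord0 i)).

Definition hmul p q : heis := (p.1 + q.1, p.2 + q.2 + omega p.1 q.1 *+ 2).

Definition hinv p : heis := (- p.1, - p.2).

Definition normsq (z : 'rV[alg R K]_n.-1) : R := \sum_i knorm (z ord0 i) ^+ 2.

Definition gauge p : R :=
  (normsq p.1 ^+ 2 + knorm (val p.2) ^+ 2) `^ (4^-1).

Definition dH p q : R := gauge (hmul (hinv q) p).

Definition hinversion (x : option heis) : option heis :=
  match x with
  | None => Some horigin
  | Some p =>
      if p == horigin then None
      else
        let A : alg R K := - kreal K (normsq p.1) + val p.2 in
        Some (map_mx (fun z => kmul z (kinv A)) p.1,
              (knorm A ^- 2) *: im_conj p.2)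
  end.

End Heisenberg.

(* A set S with base point o, compactified by the point None. *)
Section MoebiusGeometry.
Variables (R : realType) (S : choiceType).
Implicit Types (d : S -> S -> R) (o : S).

Record is_metric d : Prop := {
  metric_ge0 : forall p q, 0 <= d p q;
  metric_eq0 : forall p q, d p q = 0 <-> p = q;
  metric_sym : forall p q, d p q = d q p;
  metric_triangle : forall p q r, d p r <= d p q + d q r }.

Definition dext d (x y : option S) : \bar R :=
  match x, y with
  | Some p, Some q => (d p q)%:E
  | None, None => 0%E
  | _, _ => +oo%E
  end.

(* option S, carrying the d-topology *)
Definition dspace o d : Type := option S.

Definition dopen o d (A : set (option S)) : Prop :=
  (forall p, A (Some p) -> exists2 e : R, 0 < e &
     [set y | (dext d (Some p) y < e%:E)%E] `<=` A) /\
  (A None -> exists2 r : R, 0 < r &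
     [set y | (r%:E < dext d (Some o) y)%E] `<=` A).

Lemma dopenT o d : dopen o d setT.
Proof. by split=> *; exists 1. Qed.

Lemma dopenI o d : setI_closed (dopen o d).
Proof.
move=> A B [A1 A2] [B1 B2]; split=> [p [/A1 [e e0 eA] /B1 [f f0 fB]]|].
  exists (Num.min e f); first by rewrite lt_min e0.
  move=> y /= hy; split; [apply: eA|apply: fB]; apply: (lt_le_trans hy);
    by rewrite lee_fin ge_min lexx ?orbT.
move=> [/A2 [e e0 eA] /B2 [f f0 fB]].
exists (Num.max e f); first by rewrite lt_max e0.
move=> y /= hy; split; [apply: eA|apply: fB]; apply: (le_lt_trans _ hy);
  by rewrite lee_fin le_max lexx ?orbT.
Qed.

Lemma dopen_bigcup o d (I : Type) (f : I -> set (option S)) :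
  (forall i, dopen o d (f i)) -> dopen o d (\bigcup_i f i).
Proof.
move=> h; split=> [p [i _ /(proj1 (h i)) [e e0 eA]]|[i _ /(proj2 (h i)) [e e0 eA]]];
  by exists e => // y /eA fy; exists i.
Qed.

HB.instance Definition _ o d := Choice.on (dspace o d).
HB.instance Definition _ o d :=
  isOpenTopological.Build (dspace o d)
    (@dopenT o d) (@dopenI o d) (@dopen_bigcup o d).

Definition homeomorphism o d (phi : option S -> option S) : Prop :=
  continuous (phi : dspace o d -> dspace o d) /\
  exists psi : option S -> option S,
    [/\ cancel phi psi, cancel psi phi &
        continuous (psi : dspace o d -> dspace o d)].

(* Each of p1, ..., p4 occurs once in a numerator and once in a denominator of
   the cross-ratio, so replacing the factors that contain infinity by 1 cancels
   them. *)
Definition cr_factor d (x y : option S) : R :=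
  match x, y with Some p, Some q => d p q | _, _ => 1 end.

Definition cross_ratio d (p1 p2 p3 p4 : option S) : R :=
  cr_factor d p4 p2 / cr_factor d p4 p1 *
  (cr_factor d p3 p1 / cr_factor d p3 p2).

Definition Moebius o d : set (option S -> option S) :=
  [set phi | homeomorphism o d phi /\
    forall p1 p2 p3 p4, uniq [:: p1; p2; p3; p4] ->
      cross_ratio d (phi p1) (phi p2) (phi p3) (phi p4) =
      cross_ratio d p1 p2 p3 p4].

Definition Sim o d : set (option S -> option S) :=
  [set phi | Moebius o d phi /\
    exists2 k : R, 0 < k & forall p q : S,
      dext d (phi (Some p)) (phi (Some q)) = (k%:E * dext d (Some p) (Some q))%E].

End MoebiusGeometry.

(* Main.v *)
From mathcomp Require Import all_boot all_order all_algebra.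
From mathcomp Require Import all_classical all_reals all_analysis.
From mathcomp Require Import ring lra.
Require Import Defs.

(** Write N(p) for d(o, p) and I for the inversion.

    Every similarity of the Koranyi metric multiplies d by a constant. For left
    translations this constant is a homomorphism to the positive reals which is
    unchanged by dilations, hence trivial (d_hmul). So d(p, q) = N(q^-1 p),
    N(p^-1) = N(p), and it remains to show N(p) = beta |p|^alpha.

    Spheres. Invariance of the cross-ratio of p, q, o, infinity under I says that
    N(p) N(I p) does not depend on p (N_inversion). If p = (z, v) has gauge 1,
    then (I p)^-1 = (z u, v) for the unit element u = |z|^2 + v (inversion_twist);
    so it suffices that N takes the same value at (z, v) and (z u, v): then
    N(p)^2 is constant on the unit sphere (N_gauge1).
    If K is associative, (w, x) |-> (w u, (u^* x) u) is a similarity which fixes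
    v, and its constant k satisfies k^2 = 1 because N(z, v) N(z u, v) and
    N(z u, v) N(z u u, v) agree (N_twist_assoc).
    For octonions the Moufang identity makes this map a similarity when u is an
    imaginary unit (rotator_imaginary). Such a rotation has constant 1, since its
    square takes (z, 0) to the group inverse of (z, 0). Choosing an imaginary
    unit m orthogonal to v and m' with (z m') m = z u, one finds that m' is again
    an imaginary unit orthogonal to v (rotation_factorization); the product of
    the two rotations takes (z, v) to (z u, v) (N_twist_octonion).

    Radii. The dilation by t multiplies N by D(t), where D is multiplicative. The
    sequence alternating between o and the orbit of p under the powers of a
    contraction converges to o for the Koranyi metric, hence converges for d, and
    its limit can only be o (N_contraction). So D(t) > 1 for t > 1, and a
    monotone multiplicative function is a power (monotone_multiplicative_powR).
    The triangle inequality bounds D(2) by 2, which gives alpha <= 1.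

    To apply the hypothesis on similarities one has to know that translations,
    dilations and rotations are Moebius for the Koranyi metric. This needs only
    that they scale it and control neighbourhoods of infinity (scaling_Sim), for
    which a crude bound on the group law is enough (hmul_bounded). The algebra
    rests on two facts: the trace form is associative in every Cayley-Dickson
    algebra (cd_re_mulA), and the norm is multiplicative up to the octonions
    (nsqM); from these the alternative and Moufang laws follow by duality. *)

Set Implicit Arguments.
Unset Strict Implicit.
Unset Printing Implicit Defensive.

Import Order.TTheory GRing.Theory Num.Theory.
Import numFieldNormedType.Exports.

Local Open Scope classical_set_scope.
Local Open Scope ring_scope.

(** * Cayley-Dickson algebras *)

Section CayleyDicksonTheory.
Variable R : realType.
Implicit Types (a : R) (k : nat).

Local Notation "x ** y" := (@cd_mul R _ x y) (at level 40, left associativity).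
Local Notation "x ^c" := (@cd_conj R _ x) (at level 1, format "x ^c").
Local Notation re := (@cd_re R _).

Lemma cd_conj_realE k a : (@cd_real R k a)^c = @cd_real R k a.
Proof. by elim: k => [|k IH] //=; rewrite IH oppr0. Qed.

Lemma cd_conj0 k : (0 : cd R k)^c = 0.
Proof. exact: raddf0. Qed.

Lemma cd_real0 k : @cd_real R k 0 = 0.
Proof. by elim: k => [|k IH] //=; rewrite IH. Qed.

Lemma cd_mulDlr k :
  (forall x y z : cd R k, (x + y) ** z = x ** z + y ** z) /\
  (forall x y z : cd R k, z ** (x + y) = z ** x + z ** y).
Proof.
elim: k => [|k [IHl IHr]].
  by split=> x y z /=; [exact: mulrDl | exact: mulrDr].
split=> x y z /=.
  by rewrite !(IHl, IHr) opprD; congr pair; exact: addrACA.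
by rewrite !raddfD /= !(IHl, IHr) opprD; congr pair; exact: addrACA.
Qed.

Lemma cd_mulDl k (x y z : cd R k) : (x + y) ** z = x ** z + y ** z.
Proof. exact: (cd_mulDlr k).1. Qed.

Lemma cd_mulDr k (x y z : cd R k) : z ** (x + y) = z ** x + z ** y.
Proof. exact: (cd_mulDlr k).2. Qed.

Lemma cd_mulZlr k :
  (forall a (x y : cd R k), (a *: x) ** y = a *: (x ** y)) /\
  (forall a (x y : cd R k), x ** (a *: y) = a *: (x ** y)).
Proof.
elim: k => [|k [IHl IHr]].
  by split=> a x y /=; [exact: esym (mulrA _ _ _) | exact: mulrCA].
by split=> a x y /=; rewrite ?linearZ /= !(IHl, IHr) -scalerN -!scalerDr.
Qed.

Lemma cd_mulZl k a (x y : cd R k) : (a *: x) ** y = a *: (x ** y).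
Proof. exact: (cd_mulZlr k).1. Qed.

Lemma cd_mulZr k a (x y : cd R k) : x ** (a *: y) = a *: (x ** y).
Proof. exact: (cd_mulZlr k).2. Qed.

Lemma cd_mulNl k (x y : cd R k) : (- x) ** y = - (x ** y).
Proof. by rewrite -scaleN1r cd_mulZl scaleN1r. Qed.

Lemma cd_mulNr k (x y : cd R k) : x ** (- y) = - (x ** y).
Proof. by rewrite -scaleN1r cd_mulZr scaleN1r. Qed.

Lemma cd_mul0l k (x : cd R k) : 0 ** x = 0.
Proof. by have := cd_mulZl 0 0 x; rewrite !scale0r. Qed.

Lemma cd_mul0r k (x : cd R k) : x ** 0 = 0.
Proof. by have := cd_mulZr 0 x 0; rewrite !scale0r. Qed.

Lemma cd_conjM k (x y : cd R k) : (x ** y)^c = y^c ** x^c.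
Proof.
elim: k x y => [|k IH] x y /=; first exact: mulrC.
rewrite raddfB /= !IH !cd_conjK raddfN /= !cd_mulNl !cd_mulNr opprK.
by congr pair; rewrite opprD addrC.
Qed.

Lemma cd_reD k (x y : cd R k) : re (x + y) = re x + re y.
Proof. by elim: k x y => [|k IH] x y //=; rewrite IH. Qed.

Lemma cd_reZ k a (x : cd R k) : re (a *: x) = a * re x.
Proof. by elim: k x => [|k IH] x //=; rewrite IH. Qed.

Lemma cd_reN k (x : cd R k) : re (- x) = - re x.
Proof. by rewrite -scaleN1r cd_reZ mulN1r. Qed.

Lemma cd_reB k (x y : cd R k) : re (x - y) = re x - re y.
Proof. by rewrite cd_reD cd_reN. Qed.

Lemma cd_re_conj k (x : cd R k) : re x^c = re x.
Proof. by elim: k x => [|k IH] x //=. Qed.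

Lemma cd_re_real k a : re (@cd_real R k a) = a.
Proof. by elim: k => [|k IH] //=. Qed.

Lemma cd_mul_real k a (x : cd R k) :
  @cd_real R k a ** x = a *: x /\ x ** @cd_real R k a = a *: x.
Proof.
elim: k x => [|k IH] x /=; first by split; rewrite // mulrC.
rewrite cd_conj_realE !(IH _).1 !(IH _).2.
by rewrite cd_conj0 !cd_mul0r !cd_mul0l !subr0 addr0 add0r.
Qed.

Lemma cd_real_mull k a (x : cd R k) : @cd_real R k a ** x = a *: x.
Proof. by have [] := cd_mul_real a x. Qed.

Lemma cd_real_mulr k a (x : cd R k) : x ** @cd_real R k a = a *: x.
Proof. by have [] := cd_mul_real a x. Qed.

Lemma cd_addconj k (x : cd R k) : x + x^c = @cd_real R k (2 * re x).
Proof.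
elim: k x => [|k IH] x /=; first by rewrite mulr_natl.
by rewrite -IH -[0](subrr x.2).
Qed.

Lemma cd_re_mulC k (x y : cd R k) : re (x ** y) = re (y ** x).
Proof.
elim: k x y => [|k IH] x y /=; first exact: mulrC.
by rewrite !cd_reB IH -[re (_^c ** _)]cd_re_conj cd_conjM cd_conjK.
Qed.

(** The algebra is not associative in general, but the trace form is: the
    second components of the two triple products differ, the first components
    agree up to the cyclic symmetry of the real part one level below. *)
Lemma cd_re_mulA k (x y z : cd R k) : re (x ** y ** z) = re (x ** (y ** z)).
Proof.
elim: k x y z => [|k IH] x y z /=; first by rewrite mulrA.
rewrite raddfD /= !cd_conjM !cd_conjK.
rewrite !(cd_mulDl, cd_mulDr, cd_mulNl, cd_mulNr) !(cd_reD, cd_reN) IH.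
have cyc (u v w : cd R k) : re (u ** (v ** w)) = re (v ** (w ** u)).
  by rewrite cd_re_mulC IH.
rewrite !IH (cyc x.1 (z.2^c)) (cyc z.1) (cyc (y.1^c)); ring.
Qed.

Lemma cd_mulA k (x y z : cd R k) :
  (k <= 2)%N -> x ** y ** z = x ** (y ** z).
Proof.
case: k x y z => [|[|[|//]]] /= x y z _.
- by rewrite mulrA.
- by congr (_, _) => /=; ring.
- by congr ((_, _), (_, _)) => /=; ring.
Qed.

(** * The Euclidean inner product and the composition property *)

Definition dot k (x y : cd R k) : R := re (x ** y^c).

Local Notation nsq x := (dot x x).

Lemma dot_pair k (x y : cd R k.+1) : dot x y = dot x.1 y.1 + dot x.2 y.2.
Proof.
by rewrite /dot /= raddfN /= cd_mulNl opprK cd_reD [re (y.2^c ** _)]cd_re_mulC.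
Qed.

Lemma dotC k (x y : cd R k) : dot x y = dot y x.
Proof. by rewrite /dot -cd_re_conj cd_conjM cd_conjK. Qed.

Lemma dotDl k (x y z : cd R k) : dot (x + y) z = dot x z + dot y z.
Proof. by rewrite /dot cd_mulDl cd_reD. Qed.

Lemma dotDr k (x y z : cd R k) : dot z (x + y) = dot z x + dot z y.
Proof. by rewrite !(dotC z) dotDl. Qed.

Lemma dotZl k a (x y : cd R k) : dot (a *: x) y = a * dot x y.
Proof. by rewrite /dot cd_mulZl cd_reZ. Qed.

Lemma dotZr k a (x y : cd R k) : dot x (a *: y) = a * dot x y.
Proof. by rewrite !(dotC x) dotZl. Qed.

Lemma dotNl k (x y : cd R k) : dot (- x) y = - dot x y.
Proof. by rewrite -scaleN1r dotZl mulN1r. Qed.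

Lemma dotNr k (x y : cd R k) : dot x (- y) = - dot x y.
Proof. by rewrite -scaleN1r dotZr mulN1r. Qed.

Lemma dot_conj k (x y : cd R k) : dot x^c y^c = dot x y.
Proof. by rewrite /dot cd_conjK cd_re_mulC -cd_re_conj cd_conjM cd_conjK. Qed.

Lemma dot_real k a (x : cd R k) : dot x (@cd_real R k a) = a * re x.
Proof. by rewrite /dot cd_conj_realE cd_real_mulr cd_reZ. Qed.

Lemma nsq_ge0 k (x : cd R k) : 0 <= nsq x.
Proof.
elim: k x => [|k IH] x; first by rewrite /dot /= -expr2 sqr_ge0.
by rewrite dot_pair addr_ge0.
Qed.

Lemma nsq_eq0 k (x : cd R k) : (nsq x == 0) = (x == 0).
Proof.
elim: k x => [|k IH] x; first by rewrite /dot /= mulf_eq0 orbb.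
by rewrite dot_pair paddr_eq0 ?nsq_ge0 // !IH; case: x.
Qed.

Lemma nsqZ k a (x : cd R k) : nsq (a *: x) = a ^+ 2 * nsq x.
Proof. by rewrite dotZl dotZr mulrA expr2. Qed.

Lemma dot_inj k (x y : cd R k) : (forall t, dot x t = dot y t) -> x = y.
Proof.
move=> xy; apply/eqP; rewrite -subr_eq0 -nsq_eq0 dotDl xy -dotDl subrr.
by rewrite -{1}(scale0r 0) dotZl mul0r.
Qed.

Lemma dot_mull k (x y z : cd R k) : dot (x ** y) z = dot x (z ** y^c).
Proof. by rewrite /dot cd_re_mulA cd_conjM cd_conjK. Qed.

Lemma dot_mulr k (x y z : cd R k) : dot (x ** y) z = dot y (x^c ** z).
Proof. by rewrite /dot cd_conjM cd_conjK -cd_re_mulA [RHS]cd_re_mulC cd_re_mulA. Qed.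

(** Hurwitz: doubling an associative composition algebra gives a composition
    algebra, because the two cross terms of the norm of a product are equal as
    soon as one level below the products may be rebracketed. *)
Lemma nsqM k (x y : cd R k) : (k <= 3)%N -> nsq (x ** y) = nsq x * nsq y.
Proof.
elim: k x y => [|k IH] x y k3; first by rewrite /dot /=; ring.
have {}IH := IH _ _ (ltnW k3).
rewrite !dot_pair /= !(dotDl, dotDr, dotNl, dotNr) !IH !dot_conj.
have cross : dot (x.1 ** y.1) (y.2^c ** x.2) = dot (y.2 ** x.1) (x.2 ** y.1^c).
  by rewrite dot_mull dot_mulr cd_mulA.
rewrite [dot (y.2^c ** _) (_ ** _)]dotC [dot (x.2 ** _) (_ ** _)]dotC cross; ring.
Qed.

Section Composition.
Variables (k : nat) (k3 : (k <= 3)%N).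
Implicit Types x y z u m : cd R k.

(** The composition law, polarised in the right factor. *)
Lemma dot_mul2l x y z : dot (x ** y) (x ** z) = nsq x * dot y z.
Proof.
have := nsqM x (y + z) k3.
rewrite cd_mulDr !(dotDl, dotDr) !nsqM // [dot (x ** z) _]dotC [dot z y]dotC.
by move=> h; lra.
Qed.

(** The composition law, polarised in both factors. *)
Lemma dot_exchange x y u z :
  dot (x ** y) (u ** z) = 2 * dot x u * dot y z - dot (x ** z) (u ** y).
Proof.
have := dot_mul2l (x + u) y z.
rewrite !cd_mulDl !(dotDl, dotDr) !dot_mul2l [dot (u ** y) _]dotC [dot u x]dotC.
by move=> h; lra.
Qed.

Lemma cd_mulKl x y : x^c ** (x ** y) = nsq x *: y.
Proof.
by apply: dot_inj => t; rewrite dot_mulr cd_conjK dot_mul2l dotZl.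
Qed.

Lemma cd_mulKr x y : y ** x ** x^c = nsq x *: y.
Proof.
apply: (can_inj (@cd_conjK R k)).
by rewrite !cd_conjM cd_conjK -{1}[x]cd_conjK cd_mulKl dot_conj linearZ.
Qed.

(** The middle Moufang identity. Pairing the left-hand side with a test vector
    and exchanging gives an expression in which y and z occur only through
    their product y ** z; hence y, z may be replaced by y ** z, 1. *)
Lemma cd_moufang x y z : (x ** y) ** (z ** x) = (x ** (y ** z)) ** x.
Proof.
have key y' z' t : dot ((x ** y') ** (z' ** x)) t =
    2 * dot x t * dot (y' ** z') x^c - nsq x * dot ((y' ** z')^c) t.
  rewrite dot_mull cd_conjM dot_exchange -dot_mull; congr (_ - _).
  rewrite -{1}[x]cd_conjK cd_mulKl dotZl dot_conj; congr (_ * _).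
  by rewrite dotC dot_mull -cd_conjM dotC.
apply: dot_inj => t; rewrite key.
have -> : x ** (y ** z) ** x = x ** (y ** z) ** (@cd_real R k 1 ** x).
  by rewrite cd_real_mull scale1r.
by rewrite key cd_real_mulr scale1r.
Qed.

Lemma cd_flex x y : x ** y ** x = x ** (y ** x).
Proof.
have := cd_moufang x (@cd_real R k 1) y.
by rewrite cd_real_mulr cd_real_mull !scale1r => ->.
Qed.

Lemma cd_flexc x y : x^c ** y ** x = x^c ** (y ** x).
Proof.
have -> : x^c = @cd_real R k (2 * cd_re x) - x.
  by rewrite -cd_addconj addrAC subrr add0r.
by rewrite !cd_mulDl !cd_mulNl !cd_real_mull cd_mulZl cd_flex.
Qed.

End Composition.

(** Two of the imaginary units of the quaternion subalgebra span a plane, and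
    this plane meets the orthogonal complement of v. *)
Lemma exists_orthogonal_imaginary (v : cd R 3) :
  exists m : cd R 3, [/\ m^c = - m, dot m m = 1 & re (m ** v) = 0].
Proof.
case: v => [[[v0 v1] [v2 v3]] [[v4 v5] [v6 v7]]].
pose m a b : cd R 3 := (((0, a), (b, 0)), ((0, 0), (0, 0))).
have mc a b : cd_conj (m a b) = - m a b.
  by rewrite /m /=; congr (((_, _), (_, _)), ((_, _), (_, _))); rewrite /= ?oppr0.
have mm a b : dot (m a b) (m a b) = a ^+ 2 + b ^+ 2.
  rewrite !dot_pair /dot /=; ring.
have mv a b : cd_re (cd_mul (m a b) (((v0, v1), (v2, v3)), ((v4, v5), (v6, v7)))) =
    - (a * v1 + b * v2).
  rewrite /m /=; ring.
have [v12|v12] := eqVneq (v1 ^+ 2 + v2 ^+ 2) 0.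
  exists (m 1 0); rewrite mc mm mv; split=> //; first by ring.
  have /eqP := v12; rewrite paddr_eq0 ?sqr_ge0 // !sqrf_eq0 => /andP[/eqP-> _].
  by rewrite mulr0 mul0r addr0 oppr0.
pose s := Num.sqrt (v1 ^+ 2 + v2 ^+ 2).
have s2 : s ^+ 2 = v1 ^+ 2 + v2 ^+ 2 by rewrite sqr_sqrtr // addr_ge0 // sqr_ge0.
have s0 : s != 0 by rewrite -sqrf_eq0 s2.
exists (m (v2 / s) (- v1 / s)); rewrite mc mm mv; split=> //.
  by rewrite !expr_div_n sqrrN -mulrDl addrC -s2 divff // expf_neq0.
by field.
Qed.

End CayleyDicksonTheory.

Lemma octonion_orthogonal_imaginary (R : realType) (K : division_algebra)
  (v : alg R K) : K = OO ->
  exists m : alg R K, [/\ kconj m = - m, dot (m : cd R (cd_level K)) m = 1 &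
                         cd_re (kmul m v) = 0].
Proof. by move=> KO; subst K; exact: exists_orthogonal_imaginary. Qed.

(** * Multiplicative functions of a positive real variable *)

Section PowerFunctions.
Variable R : realType.

(** Comparing g (N x) with the values of g at the two integers next to N x
    bounds N |g x - x g 1| by g 1, for every N. *)
Lemma monotone_additive_linear (g : R -> R) :
  {morph g : x y / x + y} -> {homo g : x y / x <= y} ->
  forall x, g x = x * g 1.
Proof.
move=> gD gle x.
have g0 : g 0 = 0 by apply/(addrI (g 0)); rewrite -gD !addr0.
have gN y : g (- y) = - g y by apply/(addrI (g y)); rewrite -gD !subrr.
have gMn y n : g (y *+ n) = g y *+ n.
  by elim: n => [|n IH]; rewrite ?mulr0n // !mulrS gD IH.
have gz (m : int) : g m%:~R = m%:~R * g 1.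
  by case: m => n; rewrite ?NegzE ?mulrNz ?gN ?mulNr -?pmulrn gMn mulr_natl.
have g1 : 0 <= g 1 by rewrite -g0 gle.
have bound (n : nat) : n%:R * `|g x - x * g 1| <= g 1.
  rewrite -{1}(ger0_norm (ler0n R n)) -normrM mulrBr mulrA.
  have gn : g (n%:R * x) = n%:R * g x by rewrite !mulr_natl gMn.
  set y := n%:R * x in gn *.
  have := gle _ _ (floor_le y); have := gle _ _ (ltW (floorD1_gt y)).
  rewrite !gz gn; have := floor_le y; have := ltW (floorD1_gt y).
  rewrite intrD => h1 h2 h3 h4.
  have := ler_wpM2r g1 h1; have := ler_wpM2r g1 h2.
  by rewrite ler_norml; lra.
apply/eqP; rewrite -subr_eq0 -normr_le0 leNgt; apply/negP => c0.
have := bound (Num.truncn (g 1 / `|g x - x * g 1|)).+1.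
by rewrite leNgt -ltr_pdivrMr // truncnS_gt.
Qed.

Lemma monotone_multiplicative_powR (f : R -> R) :
  (forall t, 0 < t -> 0 < f t) ->
  (forall s t, 0 < s -> 0 < t -> f (s * t) = f s * f t) ->
  (forall t, 1 < t -> 1 < f t) ->
  exists2 a, 0 < a & forall t, 0 < t -> f t = t `^ a.
Proof.
move=> f0 fM f1; pose g (x : R) := ln (f (expR x)).
have e0 (x : R) := expR_gt0 x.
have gD : {morph g : x y / x + y}.
  by move=> x y; rewrite /g expRD fM // lnM ?posrE ?f0.
have gle : {homo g : x y / x <= y}.
  move=> x y; rewrite le_eqVlt => /predU1P[->//|xy].
  rewrite -(subrK x y) gD lerDr; apply/ltW/ln_gt0/f1.
  by rewrite expR_gt1 subr_gt0.
exists (g 1).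
  by apply/ln_gt0/f1; rewrite expR_gt1 ltr01.
move=> t t0.
have := monotone_additive_linear gD gle (ln t).
rewrite /g lnK ?posrE // => h.
by rewrite /powR gt_eqF // mulrC -h lnK // posrE f0.
Qed.

End PowerFunctions.

(** * Similarities and convergence in a compactified distance space *)

Section Similarities.
Variables (R : realType) (S : choiceType) (o : S).
Implicit Types (d : S -> S -> R) (phi : S -> S).

(** Neighbourhoods of infinity are measured from o, which phi may move; as d
    satisfies no triangle inequality here, the behaviour of phi near infinity
    is a condition of its own. *)
Definition proper_scaling d (k : R) phi :=
  (forall p q, d (phi p) (phi q) = k * d p q) /\
  (forall r, exists s, forall p, s < d o p -> r < d o (phi p)).

Lemma proper_scaling_continuous d k phi : 0 < k -> proper_scaling d k phi ->
  continuous (omap phi : dspace o d -> dspace o d).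
Proof.
move=> k0 [phik phioo]; apply/continuousP => A [A1 A2]; split.
  move=> p /A1 [e e0 eA]; exists (e / k); first exact: divr_gt0.
  move=> [q|] //=; rewrite lte_fin => pq; apply: eA => /=.
  by rewrite lte_fin phik mulrC -ltr_pdivlMr.
move=> /A2 [r r0 rA]; have [s sr] := phioo r.
exists (Num.max s 1); first by rewrite lt_max ltr01 orbT.
move=> [q|] //=; last by move=> _; apply: rA => /=; rewrite ltry.
rewrite lte_fin gt_max => /andP[sq _]; apply: rA => /=.
by rewrite lte_fin sr.
Qed.

(** At most one of the points is infinite, and then one distance is cancelled
    in the numerator and one in the denominator, so that the powers of k still
    balance. *)
Lemma scaling_cross_ratio d k phi p1 p2 p3 p4 : 0 < k ->
  (forall p q, d (phi p) (phi q) = k * d p q) -> uniq [:: p1; p2; p3; p4] ->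
  cross_ratio d (omap phi p1) (omap phi p2) (omap phi p3) (omap phi p4) =
  cross_ratio d p1 p2 p3 p4.
Proof.
move=> k0 phik.
have kk (a b : R) : k * a / (k * b) = a / b.
  by rewrite -mulf_div divff ?mul1r // gt_eqF.
have kk' (a b : R) : (k * a)^-1 * (k * b) = a^-1 * b by rewrite mulrC kk mulrC.
case: p1 => [p1|]; case: p2 => [p2|]; case: p3 => [p3|]; case: p4 => [p4|] //=;
  rewrite /cross_ratio /= ?phik ?kk ?divr1 ?div1r ?mul1r ?mulr1 ?kk ?kk' //;
  by rewrite ?inE ?andbF.
Qed.

Lemma scaling_Sim d k phi psi : 0 < k ->
  cancel phi psi -> cancel psi phi ->
  proper_scaling d k phi -> proper_scaling d k^-1 psi ->
  Sim o d (omap phi).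
Proof.
move=> k0 phiK psiK phik psik; split; last by exists k => // p q /=; rewrite phik.1.
split; last by move=> *; apply: scaling_cross_ratio phik.1 _.
split; first exact: proper_scaling_continuous phik.
exists (omap psi); split.
- by case=> //= p; rewrite phiK.
- by case=> //= p; rewrite psiK.
- by apply: proper_scaling_continuous psik; rewrite invr_gt0.
Qed.

Lemma Sim_scaling d phi : Sim o d (omap phi) ->
  exists2 k, 0 < k & forall p q, d (phi p) (phi q) = k * d p q.
Proof. by case=> _ [k k0 h]; exists k => // p q; have [] := h p q. Qed.

Lemma cvg_dspace d (v : nat -> S) (p : S) :
  (fun i => d p (v i)) @ \oo --> (0 : R) ->
  (fun i => Some (v i) : dspace o d) @ \oo --> (Some p : dspace o d).
Proof.
move=> vp A; rewrite nbhsE => -[B [[B1 _] Bp] BA].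
have [e e0 eB] := B1 _ Bp.
have /cvgr_lt/(_ e e0) := vp; apply: filterS => i vi.
by apply/BA/eB; rewrite /= lte_fin.
Qed.

Lemma dball_open d p e : is_metric d ->
  dopen o d [set y | (dext d (Some p) y < e%:E)%E].
Proof.
move=> dm; split=> //= q; rewrite lte_fin => pq.
exists (e - d p q); first by rewrite subr_gt0.
move=> [y|] //=; rewrite !lte_fin => qy.
by apply: le_lt_trans (metric_triangle dm p q y) _; lra.
Qed.

Lemma dball_infty_open d r : is_metric d ->
  dopen o d [set y | (r%:E < dext d (Some o) y)%E].
Proof.
move=> dm; split=> [q|_] /=; last first.
  exists (Num.max r 1); first by rewrite lt_max ltr01 orbT.
  by move=> [y|] /=; rewrite ?ltry // !lte_fin gt_max => /andP[].
rewrite lte_fin => oq; exists (d o q - r); first by rewrite subr_gt0.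
move=> [y|] //=; rewrite ?ltry // !lte_fin => qy.
have := metric_triangle dm o y q; rewrite (metric_sym dm y q); lra.
Qed.

(** A sequence which keeps returning to p can only converge to p, whence its
    other terms converge to p as well. *)
Lemma cvg_dspace_returning d (u : nat -> S) (p : S) (l : dspace o d) :
  is_metric d -> (forall n, exists2 m, (n <= m)%N & u m = p) ->
  (fun i => Some (u i) : dspace o d) @ \oo --> l ->
  forall e, 0 < e -> \forall i \near \oo, d p (u i) < e.
Proof.
move=> dm ret ul.
have near_l (A : set (option S)) : dopen o d A -> A l ->
    \forall i \near \oo, A (Some (u i)).
  by move=> Ao Al; apply: ul; apply: open_nbhs_nbhs; split.
have returns (A : set (option S)) : dopen o d A -> A l -> A (Some p).
  move=> Ao Al; have [N _ hN] := near_l A Ao Al.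
  by have [m Nm <-] := ret N; apply: hN.
case: l ul near_l returns => [q|] ul near_l returns.
  have pq : q = p.
    apply/(metric_eq0 dm)/eqP; rewrite eq_le (metric_ge0 dm) andbT leNgt.
    apply/negP => qp; have := returns _ (dball_open q (d q p) dm).
    by rewrite /= !lte_fin ltxx (metric_eq0 dm q q).2 // => /(_ qp).
  move=> e e0; have := near_l _ (dball_open q e dm).
  rewrite /= lte_fin (metric_eq0 dm q q).2 // pq => /(_ e0).
  by apply: filterS => i; rewrite lte_fin.
have := returns _ (dball_infty_open (d o p) dm).
by rewrite /= ltry lte_fin ltxx => /(_ isT).
Qed.

End Similarities.

(** * The Heisenberg group and its translations *)

Section HeisenbergTheory.
Variables (R : realType) (K : division_algebra) (n : nat).

Local Notation alg := (alg R K).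
Local Notation ImK := (ImK R K).
Local Notation H := (heis R K n).
Local Notation o := (horigin R K n).
Local Notation nsq x := (dot (x : cd R (cd_level K)) x).

Implicit Types (x y : alg) (v : ImK) (p q : H) (z w : 'rV[alg]_n.-1) (t : R).

Lemma cd_level_le3 : (cd_level K <= 3)%N. Proof. by case: K. Qed.
Hint Resolve cd_level_le3 : core.

Lemma knormE x : knorm x ^+ 2 = nsq x.
Proof. by rewrite sqr_sqrtr // nsq_ge0. Qed.

Lemma knorm_ge0 x : 0 <= knorm x. Proof. exact: sqrtr_ge0. Qed.

Lemma knorm_eq0 x : (knorm x == 0) = (x == 0).
Proof. by rewrite -sqrf_eq0 knormE nsq_eq0. Qed.

Lemma knormZ t x : 0 <= t -> knorm (t *: x) = t * knorm x.
Proof.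
move=> t0; apply/eqP.
rewrite -(eqrXn2 (ltn0Sn 1)) ?knorm_ge0 ?mulr_ge0 ?knorm_ge0 //.
by rewrite exprMn !knormE nsqZ.
Qed.

Lemma knormN x : knorm (- x) = knorm x.
Proof. by rewrite /knorm /kmul /kconj -/(dot _ _) dotNl dotNr opprK. Qed.

Lemma knorm_conj x : knorm (kconj x) = knorm x.
Proof. by rewrite /knorm /kmul -/(dot _ _) dot_conj. Qed.

Lemma knormM x y : knorm (kmul x y) = knorm x * knorm y.
Proof. by rewrite /knorm /kmul /kconj -/(dot _ _) nsqM // sqrtrM // nsq_ge0. Qed.

Lemma kconjD x y : kconj (x + y) = kconj x + kconj y.
Proof. exact: raddfD. Qed.

Lemma kconjN x : kconj (- x) = - kconj x.
Proof. exact: raddfN. Qed.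

Lemma kconj_im v : kconj (val v) = - val v.
Proof.
by have /eqP vE : val v \in @imaginary R K := valP v; rewrite [in RHS]vE opprK.
Qed.

Lemma im_partD x y : im_part (x + y) = im_part x + im_part y.
Proof.
apply: val_inj; rewrite [RHS]raddfD /= kconjD -scalerDr.
by rewrite opprD addrACA.
Qed.

Lemma im_partN x : im_part (- x) = - im_part x.
Proof. by apply: val_inj; rewrite [RHS]raddfN /= kconjN -opprD scalerN. Qed.

Lemma im_part_conj x : im_part (kconj x) = - im_part x.
Proof.
by apply: val_inj; rewrite [RHS]raddfN /= /kconj cd_conjK -scalerN opprB.
Qed.

Lemma im_part0 : im_part (0 : alg) = 0.
Proof. by apply: val_inj; rewrite [RHS]raddf0 /= /kconj cd_conj0 subr0 scaler0. Qed.

Lemma omegaDl z z' w : omega (z + z') w = omega z w + omega z' w.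
Proof.
rewrite /omega -im_partD -big_split; congr im_part.
by apply: eq_bigr => i _; rewrite mxE; exact: cd_mulDr.
Qed.

Lemma omegaNC z w : omega w z = - omega z w.
Proof.
rewrite /omega -im_part_conj raddf_sum; congr im_part; apply: eq_bigr => i _.
by rewrite /= /kmul /kconj cd_conjM cd_conjK.
Qed.

Lemma omegaDr z w w' : omega z (w + w') = omega z w + omega z w'.
Proof. by rewrite omegaNC omegaDl opprD -!omegaNC. Qed.

Lemma omegaNl z w : omega (- z) w = - omega z w.
Proof.
rewrite /omega -im_partN -sumrN; congr im_part; apply: eq_bigr => i _.
by rewrite mxE; exact: cd_mulNr.
Qed.

Lemma omega0r z : omega z 0 = 0.
Proof. by apply/(addrI (omega z 0)); rewrite -omegaDr !addr0. Qed.

Lemma omega0l z : omega 0 z = 0.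
Proof. by rewrite omegaNC omega0r oppr0. Qed.

Lemma omegazz z : omega z z = 0.
Proof.
have /eqP : omega z z *+ 2 = 0 by rewrite mulr2n {1}omegaNC addNr.
by rewrite -scaler_nat scaler_eq0 pnatr_eq0 => /eqP.
Qed.

Lemma hmulA : associative (@hmul R K n).
Proof.
move=> p q r; congr pair => /=; first by rewrite addrA.
rewrite omegaDl omegaDr !mulrnDl.
move: (omega p.1 q.1 *+ 2) (omega p.1 r.1 *+ 2) (omega q.1 r.1 *+ 2) => a b c.
rewrite !addrA [RHS]addrAC; congr (_ + _).
by rewrite [LHS]addrAC; congr (_ + _); rewrite [LHS]addrAC.
Qed.

Lemma hmul0 : left_id o (@hmul R K n).
Proof. by case=> z v; rewrite /hmul /= !add0r omega0l mul0rn addr0. Qed.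

Lemma hmulr0 : right_id o (@hmul R K n).
Proof. by case=> z v; rewrite /hmul /= !addr0 omega0r mul0rn addr0. Qed.

Lemma hmulV : left_inverse o (@hinv R K n) (@hmul R K n).
Proof.
by case=> z v; rewrite /hmul /= !addNr omegaNl omegazz oppr0 mul0rn addr0.
Qed.

Lemma hinvK : involutive (@hinv R K n).
Proof. by case=> z v; rewrite /hinv /= !opprK. Qed.

Lemma hmulrV : right_inverse o (@hinv R K n) (@hmul R K n).
Proof. by move=> p; rewrite -{1}(hinvK p) hmulV. Qed.

Lemma hmulK p : cancel (hmul p) (hmul (hinv p)).
Proof. by move=> q; rewrite hmulA hmulV hmul0. Qed.

Lemma hmulVK p : cancel (hmul (hinv p)) (hmul p).
Proof. by move=> q; rewrite hmulA hmulrV hmul0. Qed.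

Lemma hinvM p q : hinv (hmul p q) = hmul (hinv q) (hinv p).
Proof.
apply: (can_inj (hmulK (hmul p q))).
by rewrite hmulrV -hmulA (hmulA q) hmulrV hmul0 hmulrV.
Qed.

Lemma dH_hmul a p q : dH (hmul a p) (hmul a q) = dH p q.
Proof. by rewrite /dH hinvM -hmulA hmulK. Qed.

Lemma normsq_ge0 z : 0 <= normsq z.
Proof. by apply: sumr_ge0 => i _; rewrite exprn_ge0 ?knorm_ge0. Qed.

Lemma normsqN z : normsq (- z) = normsq z.
Proof. by apply: eq_bigr => i _; rewrite mxE knormN. Qed.

Lemma normsq_eq0 z : (normsq z == 0) = (z == 0).
Proof.
apply/idP/eqP => [|->]; last first.
  rewrite /normsq big1 // => i _; rewrite mxE.
  have -> : knorm (0 : alg) = 0 by apply/eqP; rewrite knorm_eq0.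
  by rewrite expr0n.
rewrite psumr_eq0 => [/allP z0|i _]; last by rewrite exprn_ge0 ?knorm_ge0.
apply/rowP => i; rewrite mxE.
have := z0 i (mem_index_enum _); rewrite sqrf_eq0 knorm_eq0.
by move=> /eqP.
Qed.

Definition gauge4 p : R := normsq p.1 ^+ 2 + knorm (val p.2) ^+ 2.

Lemma gauge4_ge0 p : 0 <= gauge4 p.
Proof. by rewrite addr_ge0 // sqr_ge0. Qed.

Lemma gauge_ge0 p : 0 <= gauge p. Proof. exact: powR_ge0. Qed.

Lemma gauge_exp4 p : gauge p ^+ 4 = gauge4 p.
Proof.
by rewrite -powR_mulrn ?gauge_ge0 // -powRrM mulVf ?pnatr_eq0 // powRr1 ?gauge4_ge0.
Qed.

Lemma gauge_eq0 p : (gauge p == 0) = (p == o).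
Proof.
have -> : (gauge p == 0) = (gauge p ^+ 4 == 0) by rewrite expf_eq0.
rewrite gauge_exp4 paddr_eq0 ?sqr_ge0 //.
rewrite !sqrf_eq0 normsq_eq0 knorm_eq0; case: p => z v /=.
by rewrite xpair_eqE -val_eqE.
Qed.

Lemma gauge0 : gauge o = 0.
Proof. by apply/eqP; rewrite gauge_eq0. Qed.

Lemma gauge_hinv p : gauge (hinv p) = gauge p.
Proof. by rewrite /gauge normsqN [val _]raddfN knormN. Qed.

Lemma dH_origin p : dH o p = gauge p.
Proof. by rewrite /dH hmulr0 gauge_hinv. Qed.

Lemma valD (u v : ImK) : val (u + v) = val u + val v.
Proof. exact: raddfD. Qed.

Lemma valMn v m : val (v *+ m) = val v *+ m.
Proof. exact: raddfMn. Qed.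

Lemma nsqD_le x y : nsq (x + y) <= 2 * (nsq x + nsq y).
Proof.
have := nsq_ge0 (x - y : cd R (cd_level K)).
rewrite !(dotDl, dotDr) !(dotNl, dotNr) [dot y x]dotC => h; lra.
Qed.

Lemma nsq_sum_le (I : Type) (r : seq I) (F : I -> alg) (b : R) :
  0 <= b -> (forall i, nsq (F i) <= b) -> nsq (\sum_(i <- r) F i) <= 4 ^+ size r * b.
Proof.
move=> b0 Fb; elim: r => [|i r IH] /=.
  have /eqP -> : nsq (\sum_(i <- [::]) F i) == 0 by rewrite nsq_eq0 big_nil.
  by rewrite expr0 mul1r.
rewrite big_cons; apply: le_trans (nsqD_le _ _) _; rewrite exprS.
have r1 : 1 <= 4 ^+ size r :> R by rewrite exprn_ege1 // ler1n.
have := Fb i; have := ler_peMl b0 r1; lra.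
Qed.

Lemma nsq_im_part x : nsq (val (im_part x)) <= nsq x.
Proof.
rewrite /= nsqZ; have := nsqD_le x (- kconj x).
rewrite [in X in _ <= X]dotNl dotNr opprK [dot (kconj x) _]dot_conj => h.
have -> : (2^-1 : R) ^+ 2 = 4^-1 by rewrite exprVn -natrX.
lra.
Qed.

Lemma omega_bounded : exists2 c : R, 0 <= c &
  forall z w, nsq (val (omega z w)) <= c * (normsq z * normsq w).
Proof.
pose r := index_enum 'I_n.-1; exists (4 ^+ size r); first exact: exprn_ge0.
move=> z w; apply: le_trans (nsq_im_part _) _.
apply: nsq_sum_le => [|i]; first by rewrite mulr_ge0 ?normsq_ge0.
have coord (y : 'rV[alg]_n.-1) : nsq (y ord0 i) <= normsq y.
  rewrite -knormE /normsq (bigD1 i) //= lerDl.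
  by apply: sumr_ge0 => j _; rewrite exprn_ge0 ?knorm_ge0.
rewrite /kmul nsqM // dot_conj mulrC.
by apply: ler_pM (coord _) (coord _); exact: nsq_ge0.
Qed.

Lemma normsqD_le z w : normsq (z + w) <= 2 * (normsq z + normsq w).
Proof.
rewrite /normsq -big_split mulr_sumr; apply: ler_sum => i _.
by rewrite mxE !knormE; exact: nsqD_le.
Qed.

Lemma le_gauge p (r : R) : gauge p <= r -> gauge4 p <= r ^+ 4.
Proof.
move=> pr; rewrite -gauge_exp4; apply: lerXn2r => //; rewrite nnegrE ?gauge_ge0 //.
exact: le_trans (gauge_ge0 p) pr.
Qed.

Lemma gauge_le p (s : R) : gauge4 p <= s -> gauge p <= 1 + s.
Proof.
rewrite -gauge_exp4 => ps; have [g1|/ltW g1] := leP (gauge p) 1.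
  by apply: le_trans g1 _; rewrite lerDl (le_trans _ ps) // exprn_ge0 ?gauge_ge0.
apply: le_trans (ler_eXnr _ g1) (le_trans ps _) => //.
by rewrite lerDr.
Qed.

(** Translations map bounded sets to bounded sets: a coarse substitute for the
    triangle inequality of the Koranyi metric, sufficient for their continuity
    at infinity. *)
Lemma hmul_bounded a (r : R) :
  exists s : R, forall q, gauge q <= r -> gauge (hmul a q) <= s.
Proof.
have [c c0 hc] := omega_bounded.
pose b := r ^+ 4; pose A := normsq a.1; pose A' := nsq (val a.2).
exists (1 + ((2 * (A + (1 + b))) ^+ 2 +
             2 * (2 * (A' + b) + 4 * (c * (A * (1 + b)))))) => q qr.
apply: gauge_le; have := le_gauge qr.
rewrite -/b /gauge4 !knormE => qb.
have q1 := normsq_ge0 q.1; have q2 := nsq_ge0 (val q.2).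
have {}q2 : nsq (val q.2) <= b by have := sqr_ge0 (normsq q.1); lra.
have {}q1 : normsq q.1 <= 1 + b.
  have := sqr_ge0 (normsq q.1 - 1); rewrite sqrrB expr1n.
  by have := nsq_ge0 (val q.2); lra.
apply: lerD.
  apply: lerXn2r; rewrite ?nnegrE ?normsq_ge0 //.
    by rewrite mulr_ge0 // addr_ge0 ?normsq_ge0 //; have := normsq_ge0 q.1; lra.
  by apply: le_trans (normsqD_le _ _) _; rewrite ler_pM2l // lerD2l.
rewrite valD; apply: le_trans (nsqD_le _ _) _.
rewrite ler_pM2l //; apply: lerD.
  rewrite valD; apply: le_trans (nsqD_le _ _) _.
  by rewrite ler_pM2l // lerD2l.
rewrite valMn -scaler_nat nsqZ -natrX ler_pM2l //.
apply: le_trans (hc _ _) _; rewrite ler_wpM2l // ler_wpM2l ?normsq_ge0 //.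
Qed.

Lemma hmul_Sim a : Sim o (@dH R K n) (omap (hmul a)).
Proof.
have prop b : proper_scaling o (@dH R K n) 1 (hmul b).
  split=> [p q|r]; first by rewrite mul1r dH_hmul.
  have [s hs] := hmul_bounded (hinv b) r; exists s => p.
  by rewrite !dH_origin !ltNge; apply: contra => /hs; rewrite hmulK.
apply: (scaling_Sim ltr01 (hmulK a) (hmulVK a) (prop a)).
by rewrite invr1.
Qed.

End HeisenbergTheory.

(** * Linear similarities fixing the origin *)

Section LinearSimilarities.
Variables (R : realType) (K : division_algebra) (n : nat).

Local Notation alg := (alg R K).
Local Notation ImK := (ImK R K).
Local Notation H := (heis R K n).
Local Notation o := (horigin R K n).
Local Notation nsq x := (dot (x : cd R (cd_level K)) x).

Implicit Types (x y : alg) (v : ImK) (p q : H) (z w : 'rV[alg]_n.-1) (t : R).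
Hint Resolve cd_level_le3 : core.

(** Additive maps of K and of Im K that act coordinatewise as an automorphism of
    the Heisenberg group scaling the gauge by t: dilations and rotations alike. *)
Record homogeneous t (f : alg -> alg) (g : ImK -> ImK) : Prop := Homogeneous {
  hom_addf : {morph f : x y / x + y};
  hom_addg : {morph g : x y / x + y};
  hom_normf : forall x, knorm (f x) = t * knorm x;
  hom_normg : forall v, knorm (val (g v)) = t ^+ 2 * knorm (val v);
  hom_im : forall x y, im_part (kmul (kconj (f y)) (f x)) =
                       g (im_part (kmul (kconj y) x)) }.

Definition hmap (f : alg -> alg) (g : ImK -> ImK) p : H := (map_mx f p.1, g p.2).

Lemma hmap_can f f' g g' : cancel f f' -> cancel g g' ->
  cancel (hmap f g) (hmap f' g').
Proof.
move=> fK gK [z v]; rewrite /hmap /= gK; congr pair.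
by apply/matrixP => i j; rewrite !mxE fK.
Qed.

Section Homogeneous.
Variables (t : R) (f : alg -> alg) (g : ImK -> ImK).
Hypotheses (t0 : 0 < t) (fg : homogeneous t f g).

Let f0 : f 0 = 0.
Proof. by apply/(addrI (f 0)); rewrite -(hom_addf fg) !addr0. Qed.

Let g0 : g 0 = 0.
Proof. by apply/(addrI (g 0)); rewrite -(hom_addg fg) !addr0. Qed.

Let fN x : f (- x) = - f x.
Proof. by apply/(addrI (f x)); rewrite -(hom_addf fg) !subrr f0. Qed.

Let gN v : g (- v) = - g v.
Proof. by apply/(addrI (g v)); rewrite -(hom_addg fg) !subrr g0. Qed.

Lemma hmap0 : hmap f g o = o.
Proof.
rewrite /hmap /= g0; congr pair.
by apply/matrixP => i j; rewrite !mxE f0.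
Qed.

Lemma hmapV p : hmap f g (hinv p) = hinv (hmap f g p).
Proof.
rewrite /hmap /hinv /= gN; congr pair.
by apply/matrixP => i j; rewrite !mxE fN.
Qed.

Lemma omega_map z w : omega (map_mx f z) (map_mx f w) = g (omega z w).
Proof.
rewrite /omega (big_morph _ (@im_partD R K) (@im_part0 R K)).
rewrite [in RHS](big_morph _ (@im_partD R K) (@im_part0 R K)).
rewrite (big_morph _ (hom_addg fg) g0); apply: eq_bigr => i _.
by rewrite !mxE (hom_im fg).
Qed.

Lemma hmapM p q : hmap f g (hmul p q) = hmul (hmap f g p) (hmap f g q).
Proof.
rewrite /hmul /hmap /= omega_map !mulr2n !(hom_addg fg); congr pair.
by apply/matrixP => i j; rewrite !mxE (hom_addf fg).
Qed.

Lemma gauge_hmap p : gauge (hmap f g p) = t * gauge p.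
Proof.
have nf : normsq (hmap f g p).1 = t ^+ 2 * normsq p.1.
  rewrite /normsq mulr_sumr; apply: eq_bigr => i _.
  by rewrite mxE (hom_normf fg) exprMn.
apply/eqP; rewrite -(eqrXn2 (ltn0Sn 3)) ?gauge_ge0 ?mulr_ge0 ?gauge_ge0 ?ltW //.
rewrite exprMn !gauge_exp4 /gauge4 nf (hom_normg fg); apply/eqP; ring.
Qed.

Lemma dH_hmap p q : dH (hmap f g p) (hmap f g q) = t * dH p q.
Proof. by rewrite /dH -hmapV -hmapM gauge_hmap. Qed.

Lemma hmap_Sim f' g' :
  cancel f f' -> cancel f' f -> cancel g g' -> cancel g' g ->
  Sim o (@dH R K n) (omap (hmap f g)).
Proof.
move=> fK f'K gK g'K.
have K1 := hmap_can fK gK; have K2 := hmap_can f'K g'K.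
apply: (scaling_Sim t0 K1 K2); split.
- exact: dH_hmap.
- move=> r; exists (r / t) => p; rewrite !dH_origin gauge_hmap.
  by rewrite ltr_pdivrMr // mulrC.
- by move=> p q; rewrite -{2}[p]K2 -{2}[q]K2 dH_hmap mulKf // gt_eqF.
- move=> r; exists (r * t) => p; rewrite !dH_origin -{1}[p]K2 gauge_hmap.
  by rewrite mulrC ltr_pM2l.
Qed.

End Homogeneous.

Lemma valZ t v : val (t *: v) = t *: val v.
Proof. exact: linearZ. Qed.

Lemma kconjZ t x : kconj (t *: x) = t *: kconj x.
Proof. exact: linearZ. Qed.

Lemma im_partZ t x : im_part (t *: x) = t *: im_part x.
Proof.
apply: val_inj; rewrite [RHS]valZ /= kconjZ -scalerBr !scalerA.
by rewrite mulrC.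
Qed.

Definition dilation t := hmap ( *:%R t) ( *:%R (t ^+ 2)).

Lemma dilation_homogeneous t : 0 <= t ->
  homogeneous t ( *:%R t) ( *:%R (t ^+ 2)).
Proof.
move=> t0; split => [x y|x y|x|v|x y]; rewrite ?scalerDr ?knormZ //.
  exact: sqr_ge0.
by rewrite -im_partZ /kmul kconjZ cd_mulZl cd_mulZr scalerA expr2.
Qed.

Lemma dilationM s t p : dilation (s * t) p = dilation s (dilation t p).
Proof.
rewrite /dilation /hmap /= scalerA exprMn; congr pair.
by apply/matrixP => i j; rewrite !mxE scalerA.
Qed.

Lemma dilation1 p : dilation 1 p = p.
Proof.
case: p => z v; rewrite /dilation /hmap /= expr1n scale1r; congr pair.
by apply/matrixP => i j; rewrite !mxE scale1r.
Qed.

Lemma dilation_Sim t : 0 < t -> Sim o (@dH R K n) (omap (dilation t)).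
Proof.
move=> t0; have tn : t != 0 by rewrite gt_eqF.
apply: (hmap_Sim t0 (dilation_homogeneous (ltW t0)) (f' := *:%R t^-1)
          (g' := *:%R (t ^+ 2)^-1)) => x /=; rewrite scalerA.
- by rewrite mulVf // scale1r.
- by rewrite mulfV // scale1r.
- by rewrite mulVf ?scale1r // expf_neq0.
- by rewrite mulfV ?scale1r // expf_neq0.
Qed.

Lemma gauge_dilation t p : 0 < t -> gauge (dilation t p) = t * gauge p.
Proof.
by move=> t0; apply: (gauge_hmap t0); apply/dilation_homogeneous/ltW.
Qed.

(** * Rotations by right multiplication *)

Lemma rot_im_subproof (u : alg) v :
  kmul (kmul (kconj u) (val v)) u \in @imaginary R K.
Proof.
have /eqP vE : val v \in @imaginary R K := valP v.
rewrite inE /kconj /kmul !cd_conjM cd_conjK -cd_flexc // -cd_mulNl -cd_mulNr.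
by rewrite {1}vE.
Qed.

Definition rot_im (u : alg) v : ImK :=
  exist _ (kmul (kmul (kconj u) (val v)) u) (rot_im_subproof u v).

(** What a unit element u has to satisfy for (z, v) |-> (z u, (u^* v) u) to be an
    automorphism of the Heisenberg group. Associativity grants it for all u, the
    Moufang identity for imaginary u. *)
Definition rotator (u : alg) := nsq u = 1 /\ forall x y,
  kmul (kconj (kmul y u)) (kmul x u) = kmul (kmul (kconj u) (kmul (kconj y) x)) u.

Definition rotation (u : alg) := hmap (fun x => kmul x u) (rot_im u).

Lemma rotation_homogeneous u : rotator u ->
  homogeneous 1 (fun x => kmul x u) (rot_im u).
Proof.
move=> [u1 uM]; have nu : knorm u = 1 by rewrite /knorm -/(dot _ _) u1 sqrtr1.
split => [x y|v w|x|v|x y].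
- exact: cd_mulDl.
- apply: val_inj; rewrite [RHS]valD.
  rewrite -[LHS]/(kmul (kmul (kconj u) (val (v + w))) u) valD.
  by rewrite /kmul cd_mulDr cd_mulDl.
- by rewrite knormM nu mul1r mulr1.
- by rewrite /= !knormM knorm_conj nu mulr1 expr1n.
rewrite uM; move: (kmul (kconj y) x) => w; apply: val_inj.
rewrite -[RHS]/(kmul (kmul (kconj u) (2^-1 *: (w - kconj w))) u) /=.
rewrite /kmul cd_mulZr cd_mulZl cd_mulDr cd_mulDl cd_mulNr cd_mulNl /kconj.
by rewrite !cd_conjM cd_conjK -cd_flexc.
Qed.

Lemma rotation_Sim u : rotator u -> Sim o (@dH R K n) (omap (rotation u)).
Proof.
move=> ur; have [u1 _] := ur; have u1' : nsq (kconj u) = 1 by rewrite [LHS]dot_conj.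
have uK y : kmul (kmul y u) (kconj u) = y.
  by rewrite /kmul /kconj cd_mulKr // u1 scale1r.
have uK' y : kmul (kmul y (kconj u)) u = y.
  by rewrite -{2}[u](@cd_conjK R) /kmul /kconj cd_mulKr // u1' scale1r.
apply: (hmap_Sim ltr01 (rotation_homogeneous ur) (f' := fun x => kmul x (kconj u))
          (g' := rot_im (kconj u))) => // v; apply: val_inj => /=.
- rewrite -[RHS]uK -/(kmul _ _); congr (kmul _ _).
  by rewrite /kmul cd_flexc // cd_mulKl // [dot _ _]u1' scale1r.
- rewrite -[RHS]uK' -/(kmul _ _); congr (kmul _ _).
  by rewrite /kmul cd_flexc // cd_conjK cd_mulKl // u1 scale1r.
Qed.

End LinearSimilarities.

Section Rotations.
Variables (R : realType) (K : division_algebra) (n : nat).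

Local Notation alg := (alg R K).
Local Notation ImK := (ImK R K).
Local Notation H := (heis R K n).
Local Notation o := (horigin R K n).
Local Notation nsq x := (dot (x : cd R (cd_level K)) x).

Implicit Types (x y : alg) (v : ImK) (p q : H) (z w : 'rV[alg]_n.-1) (t : R).
Hint Resolve cd_level_le3 : core.

Lemma rotator_assoc (u : alg) : (cd_level K <= 2)%N -> nsq u = 1 -> rotator u.
Proof.
move=> K2 u1; split=> // x y.
by rewrite /kmul /kconj cd_conjM !cd_mulA.
Qed.

Lemma rotator_imaginary (m : alg) : kconj m = - m -> nsq m = 1 -> rotator m.
Proof.
move=> mc m1; split=> // x y.
by rewrite /kmul /kconj cd_conjM -/(kconj m) mc !cd_mulNl cd_moufang.
Qed.

Lemma rotation0 u : rotator u -> rotation u o = o.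
Proof. by move=> ur; exact: (hmap0 n (rotation_homogeneous ur)). Qed.

Lemma gauge_rotation u p : rotator u -> gauge (rotation u p) = gauge p.
Proof.
by move=> ur; rewrite [LHS](gauge_hmap ltr01 (rotation_homogeneous ur)) mul1r.
Qed.

(** An element of the plane spanned by 1 and v commutes with v. *)
Lemma rot_im_fixed v (a : R) :
  nsq (kreal K a + val v) = 1 -> rot_im (kreal K a + val v) v = v.
Proof.
set u := (X in nsq X); move=> u1.
have uc : kconj u = kreal K a - val v.
  by rewrite kconjD {1}/kconj cd_conj_realE kconj_im.
have comm : kmul (kconj u) (val v) = kmul (val v) (kconj u).
  by rewrite uc /kmul cd_mulDl cd_mulDr cd_real_mull cd_real_mulr cd_mulNl cd_mulNr.
apply: val_inj; rewrite -[LHS]/(kmul (kmul (kconj u) (val v)) u) comm.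
by rewrite -{2}[u](@cd_conjK R) /kmul cd_mulKr // dot_conj u1 scale1r.
Qed.

Lemma rotation_twice_imaginary (m : alg) z : kconj m = - m -> nsq m = 1 ->
  rotation m (rotation m (z, 0)) = hinv (z, 0).
Proof.
move=> mc m1; rewrite /rotation /hmap /hinv /=; congr pair.
  apply/matrixP => i j; rewrite !mxE /kmul.
  apply: oppr_inj; rewrite -cd_mulNr -mc cd_mulKr // m1 scale1r opprK //.
have r0 : rot_im m (0 : ImK) = 0.
  by apply: val_inj; rewrite /= /kmul cd_mul0r cd_mul0l.
by rewrite !r0 oppr0.
Qed.

(** Orthogonal imaginary elements anticommute. *)
Lemma rot_im_orthogonal (m : alg) v : kconj m = - m -> nsq m = 1 ->
  cd_re (kmul m (val v)) = 0 -> val (rot_im m v) = - val v.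
Proof.
move=> mc m1 mv; have vc := kconj_im v.
have anti : kmul m (val v) = - kmul (val v) m.
  have := cd_addconj (kmul m (val v)); rewrite mv mulr0.
  rewrite {2}/kmul cd_conjM -/(kconj m) -/(kconj (val v)) mc vc.
  rewrite cd_mulNl cd_mulNr opprK => h.
  apply/eqP; rewrite -addr_eq0; apply/eqP; rewrite h.
  by rewrite cd_real0.
have vmm : kmul (kmul (val v) m) m = - val v.
  by apply: oppr_inj; rewrite opprK /kmul -cd_mulNr -mc cd_mulKr // m1 scale1r.
by rewrite /= mc -vmm; congr (kmul _ _); rewrite /kmul cd_mulNl -/(kmul _ _) anti opprK.
Qed.

Lemma re_imaginary (m : alg) : kconj m = - m -> cd_re m = 0.
Proof. by move=> mc; have := cd_re_conj m; rewrite -/(kconj m) mc cd_reN; lra. Qed.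

Lemma kmul_conj x : kmul x (kconj x) = nsq x *: kreal K 1.
Proof.
have := cd_mulKr (cd_level_le3 K) (x : cd R (cd_level K))
  (kreal K 1 : cd R (cd_level K)).
by rewrite cd_real_mull scale1r.
Qed.

(** Right multiplication by u = a + v need not be a rotation if K is not
    associative. On the single element x it agrees with the composite of two
    imaginary right multiplications, whose first factor is read off from the
    second; both factors can be taken orthogonal to v. *)
Lemma rotation_factorization x v (a : R) (m : alg) :
  let u : alg := kreal K a + val v in
  x != 0 -> nsq u = 1 -> kconj m = - m -> nsq m = 1 -> cd_re (kmul m (val v)) = 0 ->
  exists m' : alg, [/\ kconj m' = - m', nsq m' = 1,
    cd_re (kmul m' (val v)) = 0 & kmul (kmul x m') m = kmul x u].
Proof.
move=> u x0 u1 mc m1 mv; have m0 := re_imaginary mc.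
have xx : nsq x != 0 by rewrite nsq_eq0.
pose y : alg := kmul (kconj x) (kmul (kmul x u) m).
have rey : cd_re y = 0.
  rewrite /y /kmul -cd_re_mulA cd_mulKl // cd_mulZl cd_reZ cd_mulDl cd_reD.
  by rewrite cd_real_mull cd_reZ m0 mulr0 add0r cd_re_mulC mv mulr0.
have revy : cd_re (kmul y (val v)) = 0.
  rewrite /kmul cd_re_mulC -cd_re_mulA -cd_re_mulA.
  have -> : cd_mul (cd_mul (val v) (kconj x)) (cd_mul x u) =
      (a * nsq x) *: val v - nsq (kmul (val v) (kconj x)) *: kreal K 1.
    rewrite cd_mulDr cd_real_mulr cd_mulDr cd_mulZr; congr (_ + _).
      by rewrite -{2}[x](@cd_conjK R) cd_mulKr // dot_conj scalerA.
    have xv : kconj (kmul (val v) (kconj x)) = - kmul x (val v).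
      by rewrite /kconj /kmul cd_conjM cd_conjK -cd_mulNr -kconj_im.
    by rewrite -kmul_conj xv /kmul cd_mulNr opprK.
  rewrite cd_mulDl cd_mulZl cd_reD cd_reZ cd_re_mulC mv mulr0 add0r.
  by rewrite cd_mulNl cd_mulZl cd_real_mull scale1r cd_reN cd_reZ m0 mulr0 oppr0.
exists (- (nsq x)^-1 *: y); split.
- have := cd_addconj (y : cd R (cd_level K)); rewrite rey mulr0 => yc.
  rewrite kconjZ -scalerN; congr (_ *: _); apply/eqP; rewrite -addr_eq0 addrC yc.
  by rewrite cd_real0.
- rewrite nsqZ sqrrN /y /kmul !nsqM // dot_conj u1 m1 !mulr1.
  by rewrite expr2 mulrACA mulVf // mulr1.
- by rewrite /kmul cd_mulZl cd_reZ revy mulr0.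
have xy : kmul x y = nsq x *: kmul (kmul x u) m.
  by rewrite /y /kmul -{1}[x](@cd_conjK R) cd_mulKl // dot_conj.
rewrite {2}/kmul cd_mulZr -/(kmul x y) xy scalerA mulNr mulVf // scaleN1r.
by rewrite /kmul cd_mulNl -cd_mulNr -mc cd_mulKr // m1 scale1r.
Qed.

End Rotations.

(** * Metrics invariant under the similarities and the inversion *)

Section InvariantMetric.
Variables (R : realType) (K : division_algebra) (n : nat).
Hypotheses (n_ge2 : (2 <= n)%N) (n_OO : K = OO -> n = 2%N).

Local Notation alg := (alg R K).
Local Notation ImK := (ImK R K).
Local Notation H := (heis R K n).
Local Notation o := (horigin R K n).
Local Notation nsq x := (dot (x : cd R (cd_level K)) x).

Variable d : H -> H -> R.
Hypotheses (d_metric : is_metric d) (hSim : Sim o (@dH R K n) `<=` Sim o d).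

Implicit Types (p q : H) (t : R).

(* the gauge of d: since d is left-invariant, d p q is N (q^-1 p) *)
Local Notation N := (d o).

Lemma d_gt0 p q : p <> q -> 0 < d p q.
Proof.
move=> pq; rewrite lt_neqAle (metric_ge0 d_metric) andbT eq_sym.
by apply/eqP => /(metric_eq0 d_metric).
Qed.

Lemma d_scaling phi : Sim o (@dH R K n) (omap phi) ->
  exists2 k, 0 < k & forall p q, d (phi p) (phi q) = k * d p q.
Proof. by move=> /hSim; exact: Sim_scaling. Qed.

Definition ones_point : H := (const_mx (kreal K 1), 0).

Lemma ones_point_neq0 : ones_point <> o.
Proof.
have j : 'I_n.-1 by case: n n_ge2 => [|[|m]] // _; exact: ord0.
case=> /matrixP/(_ ord0 j); rewrite !mxE => /(congr1 (@cd_re R _)).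
by rewrite cd_re_real -(scale0r 0) cd_reZ mul0r => /eqP; rewrite oner_eq0.
Qed.

Let e0 : 0 < N ones_point.
Proof. by apply: d_gt0 => /esym; exact: ones_point_neq0. Qed.

Lemma hmul_hor (z : 'rV[alg]_n.-1) :
  hmul (z, 0) (z, 0) = dilation 2 (z, 0) :> H.
Proof.
rewrite /hmul /dilation /hmap /= omegazz mul0rn !addr0 scaler0; congr pair.
by apply/matrixP => i j; rewrite !mxE scaler_nat mulr2n.
Qed.

Lemma hmul_ver (v w : ImK) : hmul (0, v) (0, w) = (0, v + w) :> H.
Proof. by rewrite /hmul /= omega0r mul0rn !addr0. Qed.

Lemma hmul_split (z : 'rV[alg]_n.-1) (v : ImK) : hmul (z, 0) (0, v) = (z, v) :> H.
Proof. by rewrite /hmul /= omega0r mul0rn !addr0 add0r. Qed.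

Lemma dilation_hmul t p q : 0 < t ->
  dilation t (hmul p q) = hmul (dilation t p) (dilation t q).
Proof. by move=> t0; apply: hmapM (dilation_homogeneous K (ltW t0)) _ _. Qed.

Lemma dilation0 t : 0 < t -> dilation t o = o.
Proof. by move=> t0; exact: (hmap0 n (dilation_homogeneous K (ltW t0))). Qed.

(** The scaling factor chi of translations is a homomorphism to the positive
    reals, unchanged by dilations because these conjugate translations into
    translations. The dilation by 2 squares (z, 0) and takes (0, v) to its
    fourth power, so chi is 1 at both, hence at their product (z, v). *)
Lemma d_hmul a p q : d (hmul a p) (hmul a q) = d p q.
Proof.
have /choice [chi chiP] b : exists k, 0 < k /\
    forall p q, d (hmul b p) (hmul b q) = k * d p q.
  by have [k k0 hk] := d_scaling (hmul_Sim b); exists k.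
have chi_uniq b k : (forall p q, d (hmul b p) (hmul b q) = k * d p q) -> k = chi b.
  by move=> hk; apply: (mulIf (lt0r_neq0 e0)); rewrite -hk (chiP b).2.
have chi0 b : chi b != 0 by rewrite gt_eqF // (chiP b).1.
have chiM b c : chi (hmul b c) = chi b * chi c.
  by apply/esym/chi_uniq => p' q'; rewrite -!hmulA !(chiP _).2 mulrA.
have two0 : (0 < 2 :> R) by [].
have chiD b : chi (dilation 2 b) = chi b.
  have [k k0 hk] := d_scaling (dilation_Sim K n two0).
  have kb : k * chi b = chi (dilation 2 b) * k.
    apply: (mulIf (lt0r_neq0 e0)); rewrite -mulrA -(chiP b).2 -hk !dilation_hmul //.
    by rewrite (chiP _).2 hk mulrA.
  by apply: (mulIf (lt0r_neq0 k0)); rewrite -kb mulrC.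
have square b : chi b = chi b * chi b -> chi b = 1.
  by move=> bb; apply: (mulIf (chi0 b)); rewrite -bb mul1r.
have hor z : chi (z, 0) = 1 by apply: square; rewrite -chiM hmul_hor chiD.
have ver v : chi (0, v) = 1.
  have chi_ver2 w : chi (0, w *+ 2) = chi (0, w) ^+ 2.
    by rewrite expr2 -chiM hmul_ver mulr2n.
  have : chi (dilation 2 (0, v)) = chi (0, v) ^+ 4.
    rewrite (_ : dilation 2 (0, v) = (0, v *+ 2 *+ 2)); last first.
      rewrite /dilation /hmap /= -natrX scaler_nat -mulrnA; congr pair.
      by apply/matrixP => i j; rewrite !mxE scaler0.
    by rewrite !chi_ver2 -exprM.
  rewrite chiD => v4; have v3 : chi (0, v) ^+ 3 = 1.
    by apply: (mulIf (chi0 (0, v))); rewrite -exprSr -v4 mul1r.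
  apply/eqP; rewrite -(eqrXn2 (ltn0Sn 2)) ?ler01 ?ltW ?(chiP _).1 //.
  by rewrite v3 expr1n.
by rewrite (chiP a).2; case: a => z v; rewrite -hmul_split chiM hor ver mulr1 mul1r.
Qed.

Lemma d_gaugeE p q : d p q = N (hmul (hinv q) p).
Proof. by rewrite (metric_sym d_metric) -(d_hmul (hinv q)) hmulV. Qed.

Lemma N_hinv p : N (hinv p) = N p.
Proof. by rewrite -(d_hmul p) hmulr0 hmulrV (metric_sym d_metric). Qed.

(** ** The inversion *)

Section Inversion.
Hypothesis hInv : Moebius o d (@hinversion R K n).

(** The inversion exchanges o and infinity, so the cross-ratio of p, q, o and
    infinity turns N p / N q into N q' / N p'. *)
Lemma N_inversion p q p' q' : p <> o -> q <> o ->
  hinversion (Some p) = Some p' -> hinversion (Some q) = Some q' ->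
  N p * N p' = N q * N q'.
Proof.
move=> p0 q0 pI qI.
have [pq|/eqP pq] := eqVneq p q.
  by move: qI; rewrite -pq pI => -[<-].
have := hInv.2 (Some p) (Some q) (Some o) None.
rewrite pI qI /hinversion eqxx /cross_ratio /= !divr1 !mul1r !inE !orbF.
have someE (a b : H) : a <> b -> (Some a == Some b) = false.
  by move=> ab; apply/eqP => -[].
rewrite !someE // mulr1 => /(_ isT) h.
have Np : 0 < N p by apply: d_gt0 => /esym.
have Nq : 0 < N q by apply: d_gt0 => /esym.
have [p'0|p'0] := eqVneq (N p') 0.
  move: h; rewrite p'0 invr0 mulr0 => /esym/eqP.
  by rewrite mulf_eq0 invr_eq0 !gt_eqF.
have : N q' / N p' * (N p' * N q) = N p / N q * (N p' * N q) by rewrite h.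
rewrite mulrA divfK // [N p' * _]mulrC mulrA divfK ?gt_eqF // => <-.
by rewrite mulrC.
Qed.

(** The element u, a unit if p has gauge 1, for which the inverse of the group
    element I(p) is (z u, v). *)
Definition twist_factor p : alg := kreal K (normsq p.1) + val p.2.

Definition twist p : H := (map_mx (fun x => kmul x (twist_factor p)) p.1, p.2).

Lemma nsq_twist_factor p : nsq (twist_factor p) = gauge4 p.
Proof.
have vE := kconj_im p.2.
rewrite /twist_factor /gauge4 knormE !dotDl !dotDr [dot (kreal K _) (val p.2)]dotC.
rewrite /kreal !dot_real cd_re_real (re_imaginary vE) !mulr0 addr0 add0r.
by rewrite expr2.
Qed.

Lemma twist_factor_unit p : gauge p = 1 -> nsq (twist_factor p) = 1.
Proof. by move=> p1; rewrite nsq_twist_factor -gauge_exp4 p1 expr1n. Qed.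

Lemma inversion_twist p : gauge p = 1 ->
  hinversion (Some p) = Some (hinv (twist p)).
Proof.
move=> p1; have p4 := twist_factor_unit p1.
have vE := kconj_im p.2.
have po : (p == o) = false by rewrite -gauge_eq0 p1 oner_eq0.
rewrite /hinversion po; set A := - kreal K _ + _.
have Ac : kconj A = - twist_factor p.
  by rewrite kconjD kconjN vE {1}/kconj cd_conj_realE -opprD.
have A1 : knorm A = 1 by rewrite -knorm_conj Ac knormN /knorm -/(dot _ _) p4 sqrtr1.
have -> : kinv A = - twist_factor p by rewrite /kinv A1 expr1n invr1 scale1r.
rewrite A1 expr1n invr1 scale1r; congr (Some (_, _)).
  by apply/matrixP => i j; rewrite !mxE; exact: cd_mulNr.
by apply: val_inj; rewrite [RHS]raddfN -vE.
Qed.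

Lemma gauge1_neq0 p : gauge p = 1 -> p <> o.
Proof. by move=> p1 p0; have := gauge_eq0 p; rewrite p1 p0 eqxx oner_eq0. Qed.

Lemma N_twist_const p q : gauge p = 1 -> gauge q = 1 ->
  N p * N (twist p) = N q * N (twist q).
Proof.
move=> p1 q1; rewrite -(N_hinv (twist p)) -(N_hinv (twist q)).
by apply: N_inversion; try exact: gauge1_neq0; exact: inversion_twist.
Qed.

Lemma N_rotation u : rotator u ->
  exists2 k, 0 < k & forall p, N (rotation u p) = k * N p.
Proof.
move=> ur; have [k k0 hk] := d_scaling (rotation_Sim n ur).
by exists k => // p; rewrite -hk rotation0.
Qed.

(** If u is the twist factor of p = (z, v), then N(z u, v) = k N(z, v) and
    N(z u u, v) = k^2 N(z, v) for some k. Both N(z, v) N(z u, v) and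
    N(z u, v) N(z u u, v) are the constant of the inversion, so k^2 = 1. *)
Lemma N_twist_assoc p : (cd_level K <= 2)%N -> gauge p = 1 -> N (twist p) = N p.
Proof.
move=> K2 p1; have u1 := twist_factor_unit p1.
have ur := rotator_assoc K2 u1.
have [k k0 hk] := N_rotation ur.
have N0 : 0 < N p by apply: d_gt0 => /esym; exact: gauge1_neq0.
have tw z : rotation (twist_factor p) (z, p.2) =
    (map_mx (fun x => kmul x (twist_factor p)) z, p.2).
  by rewrite /rotation /hmap /= rot_im_fixed.
have tp : twist p = rotation (twist_factor p) p by rewrite /twist -tw; case: (p).
have up : twist_factor (twist p) = twist_factor p.
  rewrite /twist_factor /=; congr (kreal K _ + _); apply: eq_bigr => i _.
  by rewrite mxE (hom_normf (rotation_homogeneous ur)) mul1r.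
have ttp : twist (twist p) = rotation (twist_factor p) (twist p).
  by rewrite {1}/twist up -tw.
have := N_twist_const p1 (etrans (congr1 _ tp) (etrans (gauge_rotation p ur) p1)).
rewrite ttp tp !hk => h.
suff -> : k = 1 by rewrite mul1r.
have k2 : k ^+ 2 = 1.
  apply: (mulfI (lt0r_neq0 (mulr_gt0 N0 (mulr_gt0 k0 N0)))); rewrite mulr1 [RHS]h; ring.
by apply/eqP; rewrite -(eqrXn2 (ltn0Sn 1)) ?ler01 ?ltW // k2 expr1n.
Qed.

(** Two steps of the rotation take (z, 0) to its group inverse, where N has the
    same value; hence k^2 = 1 for the scaling factor k. *)
Lemma N_rotation_imaginary (m : alg) p :
  kconj m = - m -> nsq m = 1 -> N (rotation m p) = N p.
Proof.
move=> mc m1; have [k k0 hk] := N_rotation (rotator_imaginary mc m1).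
suff k1 : k = 1 by rewrite hk k1 mul1r.
have := rotation_twice_imaginary (const_mx (kreal K 1) : 'rV[alg]_n.-1) mc m1.
move=> /(congr1 N); rewrite !hk N_hinv -/ones_point mulrA => h.
have k2 : k ^+ 2 = 1 by apply: (mulIf (lt0r_neq0 e0)); rewrite mul1r expr2.
by apply/eqP; rewrite -(eqrXn2 (ltn0Sn 1)) ?ler01 ?ltW // k2 expr1n.
Qed.

(** The rotations whose product takes p to its twist are orthogonal to the
    vertical part v, so that each of them reverses v. *)
Lemma N_twist_octonion p : K = OO -> gauge p = 1 -> N (twist p) = N p.
Proof.
move=> KO p1; have n2 := n_OO KO.
have u1 := twist_factor_unit p1.
have [m [mc m1 mv]] := octonion_orthogonal_imaginary (val p.2) KO.
have [z0|z0] := eqVneq p.1 0.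
  congr N; case: p z0 {p1 u1 mv} => z v /= ->; congr pair.
  by apply/matrixP => i j; rewrite !mxE; exact: cd_mul0l.
have [i zi] : exists i, p.1 ord0 i != 0.
  apply/existsP; apply: contraNT z0 => /existsPn z0.
  by apply/eqP/rowP => i; rewrite mxE; apply/eqP/negPn/z0.
have i_uniq j : j = i.
  apply: val_inj; case: j i {zi} => [j hj] [i hi] /=.
  by move: hj hi; rewrite n2 !ltnS !leqn0 => /eqP-> /eqP->.
have [m' [mc' m1' mv' mm']] := rotation_factorization zi u1 mc m1 mv.
rewrite -[RHS](N_rotation_imaginary p mc' m1') -[RHS](N_rotation_imaginary _ mc m1).
congr N; congr pair.
  by apply/rowP => j; rewrite !mxE (i_uniq j).
have m'v := rot_im_orthogonal mc' m1' mv'.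
apply: val_inj; rewrite rot_im_orthogonal // m'v ?opprK //.
by rewrite /kmul cd_mulNr cd_reN mv oppr0.
Qed.

Lemma N_twist p : gauge p = 1 -> N (twist p) = N p.
Proof.
move=> p1; have [K2|K2] := leqP (cd_level K) 2.
  exact: N_twist_assoc.
have KO : K = OO by case: K K2.
exact: N_twist_octonion.
Qed.

(** On the unit sphere N(p)^2 = N(p) N(twist p) is constant. *)
Lemma N_gauge1 p q : gauge p = 1 -> gauge q = 1 -> N p = N q.
Proof.
move=> p1 q1; have := N_twist_const p1 q1; rewrite !N_twist //.
rewrite -!expr2 => /eqP; rewrite eqrXn2 ?(metric_ge0 d_metric) //.
by move/eqP.
Qed.

End Inversion.

(** ** The exponent *)

Section Exponent.
Hypothesis hTop : forall u : nat -> option H,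
  (exists l : dspace o (@dH R K n), (u : nat -> dspace o (@dH R K n)) @ \oo --> l) ->
  (exists l : dspace o d, (u : nat -> dspace o d) @ \oo --> l).

Lemma N_dilation : exists2 D : R -> R, forall t, 0 < t -> 0 < D t &
  forall t p, 0 < t -> N (dilation t p) = D t * N p.
Proof.
have /choice [D DP] t : exists k, 0 < t ->
    0 < k /\ forall p, N (dilation t p) = k * N p.
  have [t0|t0] := ltP 0 t; last by exists 0.
  have [k k0 hk] := d_scaling (dilation_Sim K n t0); exists k => _; split=> // p.
  by rewrite -hk dilation0.
by exists D => [t /DP[]//|t p /DP[]].
Qed.

(** The orbit of p under contractions, interlaced with o, converges to o for
    the Koranyi metric, hence converges for d, and then its limit is o. *)
Lemma N_contraction p t (e : R) : 0 < t < 1 -> 0 < e ->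
  exists k, N (dilation (t ^+ k) p) < e.
Proof.
move=> /andP[t0 t1] e_gt0.
pose u k := if odd k then dilation (t ^+ k) p else o.
have u_cvg : (fun k => dH o (u k)) @ \oo --> (0 : R).
  have tk : (fun k => t ^+ k * gauge p) @ \oo --> (0 : R).
    rewrite -(mul0r (gauge p)); apply: cvgM; last exact: cvg_cst.
    by apply: cvg_expr; rewrite ger0_norm // ltW.
  apply: (squeeze_cvgr _ (cvg_cst 0) tk); apply: nearW => k.
  rewrite dH_origin gauge_ge0 /= /u; case: ifP => _.
    by rewrite gauge_dilation // exprn_gt0.
  by rewrite gauge0 mulr_ge0 ?gauge_ge0 // exprn_ge0 // ltW.
have [|l ul] := @hTop (fun k => Some (u k)).
  by exists (Some o); exact: cvg_dspace u_cvg.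
have ret m : exists2 k, (m <= k)%N & u k = o.
  by exists m.*2; rewrite ?/u ?odd_double // -addnn leq_addr.
have [m _ hm] := cvg_dspace_returning d_metric ret ul e_gt0.
exists (m.*2.+1); have := hm m.*2.+1; rewrite /= /u /= odd_double /=; apply.
by rewrite /= -addnn -addnS leq_addr.
Qed.

(** Contractions shrink N by a factor smaller than 1, so the scaling factor of
    dilations is increasing and therefore a power. The exponent is at most 1
    since N(a a) <= 2 N(a) for a = (z, 0), whose square is its dilation by 2. *)
Lemma N_dilation_power : exists2 a : R, 0 < a <= 1 &
  forall t p, 0 < t -> N (dilation t p) = t `^ a * N p.
Proof.
have [D D0 DN] := N_dilation.
have DM s t : 0 < s -> 0 < t -> D (s * t) = D s * D t.
  move=> s0 t0; apply: (mulIf (lt0r_neq0 e0)).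
  by rewrite -DN ?mulr_gt0 // dilationM !DN // mulrA.
have D1 : D 1 = 1.
  by apply: (mulIf (lt0r_neq0 e0)); rewrite -DN // dilation1 mul1r.
have DX t k : 0 < t -> D (t ^+ k) = D t ^+ k.
  move=> t0; elim: k => [|k IH]; first by rewrite !expr0 D1.
  by rewrite !exprS DM ?exprn_gt0 // IH.
have D_gt1 t : 1 < t -> 1 < D t.
  move=> t1; have t0 : 0 < t by apply: lt_trans t1.
  have ti0 : 0 < t^-1 by rewrite invr_gt0.
  have DV : D t * D t^-1 = 1 by rewrite -DM // mulfV ?gt_eqF.
  have [k] : exists k, N (dilation (t^-1 ^+ k) ones_point) < N ones_point.
    by apply: N_contraction; rewrite // ti0 invf_lt1.
  rewrite DN ?exprn_gt0 // DX // gtr_pMl // => Dk.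
  rewrite ltNge; apply/negP => Dt1; move: Dk; rewrite ltNge => /negP; apply.
  apply: exprn_ege1; rewrite -DV ger_pMl ?D0 //.
have [a a0 Da] := monotone_multiplicative_powR D0 DM D_gt1.
exists a => [|t p t0]; last by rewrite DN // Da.
rewrite a0 /= leNgt; apply/negP => a1.
have : N (dilation 2 ones_point) <= 2 * N ones_point.
  rewrite -hmul_hor; apply: le_trans (metric_triangle d_metric _ ones_point _) _.
  by rewrite -{2}[ones_point](hmulr0) d_hmul mulr_natl mulr2n.
have two1 : 1 < 2 :> R by rewrite ltr1n.
rewrite DN // ler_pM2r // Da // leNgt => /negP; apply.
rewrite /powR gt_eqF // -{1}[2](@lnK R) ?posrE // ltr_expR.
by rewrite ltr_pMl // ln_gt0.
Qed.

End Exponent.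

End InvariantMetric.

Theorem theorem1p2 (R : realType) (K : division_algebra) (n : nat)
  (n_ge2 : (2 <= n)%N) (n_OO : K = OO -> n = 2%N) (K_neq_RR : K <> RR)
  (d : heis R K n -> heis R K n -> R) (d_metric : is_metric d)
  (hSim : Sim (horigin R K n) (@dH R K n) `<=` Sim (horigin R K n) d)
  (hTop : forall u : nat -> option (heis R K n),
     (exists l : dspace (horigin R K n) (@dH R K n),
        (u : nat -> dspace (horigin R K n) (@dH R K n)) @ \oo --> l) ->
     (exists l : dspace (horigin R K n) d,
        (u : nat -> dspace (horigin R K n) d) @ \oo --> l))
  (hInv : Moebius (horigin R K n) d (@hinversion R K n)) :
  exists beta alpha : R,
    [/\ 0 < beta, 0 < alpha <= 1 &
        forall x y : option (heis R K n),
          dext d x y = (beta%:E * dext (@dH R K n) x y `^ alpha)%E].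
Proof.
have [a a01 Na] := N_dilation_power n_ge2 d_metric hSim hTop.
have /andP[a0 _] := a01.
pose e := ones_point R K n.
have e0 : e <> horigin R K n by exact: ones_point_neq0.
have gauge_gt0 p : p <> horigin R K n -> 0 < gauge p.
  by move=> /eqP p0; rewrite lt_neqAle gauge_ge0 eq_sym gauge_eq0 p0.
(* the radial projection to the unit sphere of the gauge *)
pose hat (p : heis R K n) := dilation (gauge p)^-1 p.
have hat1 p : p <> horigin R K n -> gauge (hat p) = 1.
  by move=> /gauge_gt0 p0; rewrite gauge_dilation ?invr_gt0 // mulVf // gt_eqF.
have hatK p : p <> horigin R K n -> dilation (gauge p) (hat p) = p.
  by move=> /gauge_gt0 p0; rewrite -dilationM mulfV ?gt_eqF // dilation1.
exists (d (horigin R K n) (hat e)), a.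
have beta0 : 0 < d (horigin R K n) (hat e).
  apply: d_gt0 => // he; have := hat1 _ e0; rewrite -he.
  by rewrite gauge0 => /esym/eqP; rewrite oner_eq0.
split=> // - [p|] [q|] /=.
- rewrite -EFinM; congr (_%:E); rewrite (d_gaugeE n_ge2 d_metric hSim) /dH.
  have [->|/eqP r0] := eqVneq (hmul (hinv q) p) (horigin R K n).
    by rewrite gauge0 (metric_eq0 d_metric _ _).2 // powR0 ?mulr0 // gt_eqF.
  rewrite -{1}(hatK _ r0) Na ?gauge_gt0 // mulrC.
  by rewrite (N_gauge1 n_ge2 n_OO d_metric hSim hInv (hat1 _ r0) (hat1 _ e0)).
- by rewrite gt_eqF // gt0_muley // lte_fin.
- by rewrite gt_eqF // gt0_muley // lte_fin.
- by rewrite powR0 ?gt_eqF // mule0.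
Qed.
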